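(* Let $G=(V,E,w)$ be a symmetric weighted directed graph and consider the random rooted spanning forest $\Phi_q$ of $G$ of intensity $q$, for $q\in[0,\infty)$. (1) Let $A\subseteq E$ be a set of directed edges. Then the function $q\mapsto\mathbb{P}(\pm A\subseteq\Phi_q)$ is monotone non-increasing. (2) Furthermore, for any distinct $x,y\in V$, the function $q\mapsto U_q(x,y)$ is continuous and non-decreasing, with $U_0(x,y)=0$ and $\lim_{q\to\infty}U_q(x,y)=1$.
   Context: A weighted directed graph $G=(V,E,w)$ has a finite vertex set $V$, a set $E\subseteq\{(x,y):x,y\in V\}$ of directed edges and a weight function $w:E\to[0,\infty)$. It is symmetric if $(x,y)\in E$ implies $(y,x)\in E$ and $w(x,y)=w(y,x)$ (this is how undirected weighted graphs are interpreted). A rooted spanning forest of $G$ is a subset $F\subseteq E$ such that each vertex has at most one outgoing edge in $F$ and $F$ contains no directed cycle; its roots are the vertices without outgoing edge in $F$, $r(F)$ is the number of roots, and $\mathcal{F}$ is the set of rooted spanning forests. For $q>0$, $\Phi_q$ has law $\mathbb{P}(\Phi_q=F)=q^{r(F)}w(F)/Z(q)$, $F\in\mathcal{F}$, with $w(F)=\prod_{e\in F}w(e)$ and $Z(q)=\sum_{F\in\mathcal{F}}q^{r(F)}w(F)$; values at $q=0$ are understood as limits for $q\downarrow0$. For $e=(x,y)$ let $e^-=(y,x)$, and $\{\pm A\subseteq\Phi_q\}=\bigcap_{e\in A}(\{e\in\Phi_q\}\cup\{e^-\in\Phi_q\})$. $U_q(x,y)$ is the probability that $x$ and $y$ belong to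 different trees (connected components, ignoring orientation) of $\Phi_q$.
   Formalization: The claim U_0(x,y)=0 is stated only for x and y joined by a path of edges of positive weight; otherwise it is false, since e.g. two isolated vertices have U_q(x,y)=1 for all q. *)

(* Defs.v *)
From mathcomp Require Import all_boot all_order all_algebra.
From mathcomp Require Import all_classical all_reals all_analysis.

Set Implicit Arguments.
Unset Strict Implicit.
Unset Printing Implicit Defensive.

Import Order.TTheory GRing.Theory Num.Theory.
Import numFieldNormedType.Exports.

Local Open Scope ring_scope.

(* The weight function matters only on [edges]; its values elsewhere are
   unconstrained and never used.  Loops and zero weights are allowed. *)
Record wdigraph (R : realType) (V : finType) := WDigraph {
  edges : {set V * V};
  weight : V * V -> R;
  weight_ge0 : forall e, e \in edges -> 0 <= weight e }.

Definition rev_edge (V : finType) (e : V * V) : V * V := (e.2, e.1).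

Definition edge_rel (V : finType) (F : {set V * V}) : rel V :=
  [rel x y | (x, y) \in F].

Definition different_trees (V : finType) (F : {set V * V}) (x y : V) : bool :=
  ~~ connect [rel u v | edge_rel F u v || edge_rel F v u] x y.

(* A directed cycle may have length 1 (a loop) or 2 (an edge and its reversal). *)
Definition acyclic (V : finType) (F : {set V * V}) : Prop :=
  ~ exists2 c : seq V, c != [::] & ucycle (edge_rel F) c.

Definition forest_roots (V : finType) (F : {set V * V}) : {set V} :=
  [set x | [forall y, (x, y) \notin F]].

Section RandomForest.
Variables (R : realType) (V : finType) (G : wdigraph R V).

Definition symmetric_graph : Prop :=
  forall x y, (x, y) \in edges G ->
    (y, x) \in edges G /\ weight G (x, y) = weight G (y, x).

(* Edges of weight 0 are almost surely absent from the random forest, so the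
   relevant connectivity is through edges of positive weight. *)
Definition pos_connected (x y : V) : bool :=
  connect [rel u v | ((u, v) \in edges G) && (0 < weight G (u, v))] x y.

Definition forests : {set {set V * V}} :=
  [set F : {set V * V} |
    [&& F \subset edges G,
        [forall x, #|[set y | (x, y) \in F]| <= 1]%N
      & `[< acyclic F >] ]].

Definition forest_weight (F : {set V * V}) : R := \prod_(e in F) weight G e.

Definition partition_fun (q : R) : R :=
  \sum_(F in forests) q ^+ #|forest_roots F| * forest_weight F.

Definition gibbs (q : R) (F : {set V * V}) : R :=
  q ^+ #|forest_roots F| * forest_weight F / partition_fun q.

Local Open Scope classical_set_scope.

(* The probability that the forest of intensity q equals F; only q >= 0 and
   F in [forests] are meaningful.  The limit at 0 exists by [gibbs_cvg0]. *)
Definition forest_law (q : R) (F : {set V * V}) : R :=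
  if q == 0 then lim (gibbs s F @[s --> 0^'+]) else gibbs q F.

Definition forest_prob (q : R) (P : pred {set V * V}) : R :=
  \sum_(F in forests | P F) forest_law q F.

Definition prob_pm_subset (A : {set V * V}) (q : R) : R :=
  forest_prob q
    (fun F => [forall e in A, (e \in F) || (rev_edge e \in F)]).

Definition U (x y : V) (q : R) : R :=
  forest_prob q (fun F => different_trees F x y).

Local Close Scope classical_set_scope.

Lemma forest_weight_ge0 F : F \in forests -> 0 <= forest_weight F.
Proof.
rewrite inE => /and3P[/fintype.subsetP FE _ _].
by apply: prodr_ge0 => e eF; exact/weight_ge0/FE.
Qed.

Lemma set0_forests : finset.set0 \in forests.
Proof.
rewrite inE finset.sub0set /=; apply/andP; split.
  apply/forallP => x; rewrite (_ : [set y | _] = finset.set0) ?cards0 //.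
  by apply/finset.setP => y; rewrite !inE.
apply/asboolP => -[[//|a c] _] /ucycle_cycle /=.
by case: c => [|b c] /=; rewrite /edge_rel /= inE.
Qed.

Lemma forest_weight0 : forest_weight finset.set0 = 1.
Proof. by rewrite /forest_weight big_set0. Qed.

Lemma partition_fun_gt0 q : 0 < q -> 0 < partition_fun q.
Proof.
move=> q0; rewrite /partition_fun (bigD1 _ set0_forests) /= forest_weight0 mulr1.
rewrite ltr_pwDl ?exprn_gt0// sumr_ge0// => F /andP[FF _].
by rewrite mulr_ge0 ?exprn_ge0 ?forest_weight_ge0// ltW.
Qed.

Lemma gibbs_sum1 q : 0 < q -> \sum_(F in forests) gibbs q F = 1.
Proof.
by move=> q0; rewrite -mulr_suml divff// gt_eqF// partition_fun_gt0.
Qed.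

Local Open Scope classical_set_scope.

Lemma gibbs_cvg0 F : F \in forests -> cvg (gibbs s F @[s --> 0^'+]).
Proof.
move=> FF; have [w0|wn0] := eqVneq (forest_weight F) 0.
  rewrite (_ : gibbs^~ F = cst 0); first exact: is_cvg_cst.
  by apply/funext => q; rewrite /gibbs w0 mulr0 mul0r.
pose P (H : {set V * V}) := (H \in forests) && (forest_weight H != 0).
have PF : P F by rewrite /P FF wn0.
pose M := [arg min_(H < F | P H) #|forest_roots H|]%N.
have [PM minM] : P M /\ forall H, P H -> (#|forest_roots M| <= #|forest_roots H|)%N.
  by rewrite /M; case: arg_minnP.
pose m := #|forest_roots M|.
pose Z1 (q : R) := \sum_(H in forests) q ^+ (#|forest_roots H| - m) * forest_weight H.
have cX (k : nat) (c : R) : continuous (fun q : R => q ^+ k * c).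
  by move=> q; apply: cvgM; [exact: exprn_continuous | exact: cvg_cst].
have cZ : continuous Z1.
  by move=> q; apply: cvg_big => [|H _]; [exact: add_continuous | exact: cX].
have Z10 : Z1 0 != 0.
  rewrite gt_eqF// /Z1 (bigD1 M) /=; last by case/andP: PM.
  rewrite subnn expr0 mul1r ltr_pwDl//.
    by case/andP: PM => MF ?; rewrite lt_neqAle eq_sym forest_weight_ge0// andbT.
  apply: sumr_ge0 => H /andP[HF _].
  by rewrite mulr_ge0 ?exprn_ge0 ?forest_weight_ge0.
have cg : (fun q : R => q ^+ (#|forest_roots F| - m) * forest_weight F / Z1 q) @ 0^'+ -->
    (0 ^+ (#|forest_roots F| - m) * forest_weight F / Z1 0).
  by apply: cvg_at_right_filter; apply: cvgM; [exact: cX | apply: cvgV => //; exact: cZ].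
have eg : \forall q \near 0^'+,
    q ^+ (#|forest_roots F| - m) * forest_weight F / Z1 q = gibbs q F.
  near=> q; have q0 : 0 < q by [].
  have -> : gibbs q F = (q ^+ m * (q ^+ (#|forest_roots F| - m) * forest_weight F))
                       / (q ^+ m * Z1 q).
    rewrite /gibbs mulrA -exprD subnKC; last exact: minM.
    congr (_ / _); rewrite /partition_fun /Z1 mulr_sumr; apply: eq_bigr => H HF.
    have [->|nz] := eqVneq (forest_weight H) 0; first by rewrite !mulr0.
    by rewrite mulrA -exprD subnKC //; apply: minM; rewrite /P HF.
  by rewrite -mulf_div divff ?mul1r// expf_neq0// gt_eqF.
apply: cvgP; apply: cvg_trans cg; exact: near_eq_cvg.
Unshelve. all: by end_near. Qed.

End RandomForest.

(* Main.v *)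
Require Import Defs.
From mathcomp Require Import all_fingroup all_boot all_order all_algebra.
From mathcomp Require Import ring lra.
From mathcomp Require Import all_classical all_reals all_analysis.
Set Implicit Arguments.
Unset Strict Implicit.
Unset Printing Implicit Defensive.
Import Order.TTheory GRing.Theory Num.Theory.
Import numFieldNormedType.Exports.
Local Open Scope ring_scope.

(** A rooted forest is the same thing as a partial parent map phi on V all of
    whose orbits end at a root.  Giving each root the weight q turns the
    partition function into a determinant: expanding det (q + L), L the graph
    Laplacian, along rows gives one term per parent map, and the term of phi is
    its weight times a determinant that is 1 when phi is rooted and 0 when phi
    has a cycle ([matrix_forest]).

    For one edge a = (x, y), raising the weight of a in both directions is a
    rank-one update of L along b = 1_x - 1_y.  Hence the probability that the
    forest uses a, in either direction, is w(a) b^T (q + L)^-1 b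
    ([forest_sum_edge]), which does not increase with q because L is symmetric
    and positive semidefinite ([resolvent_form_antitone]).

    For several edges it is enough that the conditional probability of one more
    edge e, given the edges s already present, does not increase with q
    ([one_more_edge_antitone]): probabilities of edge sets are products of such
    ratios ([edges_antitone]).  Conditioning on an edge c is the limit in which
    its weight is multiplied by 1 + t with t large.  Concretely, all forest sums
    are affine in t, so the inequality for the boosted weights is a quadratic
    inequality in t, valid for every t > 0, and its leading coefficient is the
    inequality with c added to s.

    In a forest two vertices of the same tree are joined by exactly one simple
    path.  The event that x and y are in the same tree is therefore the disjoint
    union, over simple paths from x to y, of the events that the forest uses the
    edges of the path ([linked_sum]), and each of these has a non-increasing
    probability.  So U_q(x,y) is non-decreasing.

    The law is a rational function of q, extended to q = 0 by its limit, so
    that continuity and the inequalities at 0 follow from those for q > 0.  As q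
    tends to infinity the forest with the most roots, the empty one, takes all
    the mass.  As q tends to 0 only forests with the fewest roots survive, and a
    forest that separates two vertices joined by edges of positive weight never
    has the fewest roots: rerooting a tree at the endpoint u of an edge (u, v)
    that leaves it and then attaching u to v removes a root ([fewer_roots]). *)

(** * Forests as parent maps *)

Section ParentMaps.
Variable V : finType.
Implicit Types (phi : {ffun V -> option V}) (x y z u v : V).

(** [None] is a cemetery state above all roots; it is fixed by [climb], so that
    orbits are defined for all times. *)
Definition climb phi : option V -> option V := obind phi.

Definition rooted phi := [forall x, fconnect (climb phi) (Some x) None].

Definition adjacent phi : rel V :=
  [rel x y | (phi x == Some y) || (phi y == Some x)].

Lemma iter_climb_None phi k : iter k (climb phi) None = None.
Proof. by elim: k => //= k ->. Qed.

(** Well-founded induction along parents; the measure is the number of steps to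
    the cemetery. *)
Lemma rooted_ind phi : rooted phi -> forall P : V -> Prop,
  (forall x, (forall y, phi x = Some y -> P y) -> P x) -> forall x, P x.
Proof.
move=> /forallP rphi P IH x; have := iter_findex (rphi x).
move: (findex _ _ _) => k; elim: k x => [|k IHk] x //; rewrite iterSr /= => kx.
by apply: IH => y xy; apply: IHk; rewrite -xy.
Qed.

Lemma rooted_irrefl phi x : rooted phi -> phi x != Some x.
Proof.
move=> rphi; elim/(rooted_ind rphi): x => x IH.
by apply/eqP => xx; have := IH x xx; rewrite xx eqxx.
Qed.

Lemma rooted_asym phi x y : rooted phi -> phi x = Some y -> phi y != Some x.
Proof.
move=> rphi; elim/(rooted_ind rphi): x y => x IH y xy.
by apply/eqP => yx; have := IH y xy x yx; rewrite xy eqxx.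
Qed.

(** A cycle through x would also be a cycle through the parent of x, so no vertex
    on it can start the induction along parents. *)
Lemma rooted_no_return phi x y : rooted phi -> phi x = Some y ->
  ~~ fconnect (climb phi) (Some y) (Some x).
Proof.
move=> rphi xy; apply/negP => yx; have := iter_findex yx.
move: (findex _ _ _) => k; elim: k x y xy {yx} => [|k IHk] x y xy /=.
  by case=> yx; move: (rooted_irrefl x rphi); rewrite xy yx eqxx.
move=> kx.
suff : forall x k, iter k.+1 (climb phi) (Some x) != Some x.
  by move=> /(_ x k.+1); rewrite [X in X != _]iterSr /= xy /= kx eqxx.
move=> {IHk xy kx x y k} x; elim/(rooted_ind rphi): x => x IH k; apply/eqP.
rewrite iterSr /=; case xy: (phi x) => [y|]; last by rewrite iter_climb_None.
by move=> kx; have := IH y xy k; rewrite /= kx /= xy eqxx.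
Qed.

(** No vertex of a cycle can satisfy the induction of [rooted_ind].  Conversely,
    an orbit that never reaches [None] stays in the finite set [V], hence is
    eventually periodic, and its period is a cycle. *)
Lemma rooted_acyclic phi : rooted phi <->
  ~ exists2 c : seq V, c != [::] & ucycle [rel x y | phi x == Some y] c.
Proof.
split=> [rphi [c c0 /andP[cyc _]]|acyc].
  suff nc : forall x, x \notin c by case: c c0 {cyc} nc => // a c _ /(_ a); rewrite mem_head.
  move=> x; elim/(rooted_ind rphi): x => x IH; apply/negP => xc.
  have /eqP := next_cycle cyc xc.
  by move/IH; rewrite mem_next xc.
apply/forallP => x; apply/negPn/negP => xN; apply: acyc.
(* The fallback value is never used along the orbit of x, which stays away
   from the cemetery. *)
pose g z := odflt z (phi z).
have gE k : iter k (climb phi) (Some x) = Some (iter k g x).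
  elim: k => [//|k IHk]; rewrite iterS IHk; set z := iter k g x.
  rewrite [iter k.+1 g x]/= -/z /g /=; case kx: (phi z) => [//|].
  case/negP: xN; rewrite (_ : None = iter k.+1 (climb phi) (Some x)) ?fconnect_iter//.
  by rewrite iterS IHk /= kx.
have gS k : phi (iter k g x) = Some (iter k.+1 g x).
  by have := gE k.+1; rewrite [X in X = _ -> _]iterS gE.
have [j jlt jx] : exists2 j, (j < order g x)%N & iter (order g x) g x = iter j g x.
  have /loopingP/(_ (order g x))/trajectP[j jlt jE] := looping_order g x.
  by exists j.
pose z := iter j g x.
have zcyc : fcycle g (orbit g z).
  apply/(orbitPcycle 0 3); exists (order g x - j).-1.
  by rewrite prednK ?subn_gt0// /z -iterD subnK// ltnW.
exists (orbit g z).
  by rewrite -size_eq0 size_orbit -lt0n order_gt0.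
rewrite /ucycle orbit_uniq andbT.
rewrite (eq_in_cycle (P := [in orbit g z]) (e' := frel g)) //.
  move=> a b /=; rewrite -!fconnect_orbit => /iter_findex <- _.
  by rewrite -iterD gS.
Qed.
End ParentMaps.

(** * The matrix-forest theorem *)

Section MatrixForest.
Variables (R : comNzRingType) (V : finType).
Implicit Types (phi : {ffun V -> option V}) (w : V -> V -> R) (q : R).

(** Being a root is an exit towards the cemetery, of weight [q]. *)
Definition parent_weight w q phi := \prod_x oapp (w x) q (phi x).

Definition laplacian w : 'M[R]_#|V| :=
  \matrix_(i, j) ((i == j)%:R * \sum_y w (enum_val i) y
                  - w (enum_val i) (enum_val j)).

(** I - N, where N is the zero-one matrix of the partial map [phi]. *)
Definition parent_mx phi : 'M[R]_#|V| :=
  \matrix_(i, j) ((i == j)%:R - (phi (enum_val i) == Some (enum_val j))%:R).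

Lemma big_optionE (F : option V -> R) : \sum_o F o = F None + \sum_x F (Some x).
Proof.
rewrite (bigD1 None) //=; congr (_ + _).
rewrite (reindex_omap Some id) /=; last by case.
by apply: eq_bigl => x; rewrite eqxx.
Qed.

(** If [phi] is not rooted, the indicator of the vertices that never reach the
    cemetery is a nonzero kernel vector.  If [phi] is rooted, a permutation with
    a nonzero term in the Leibniz formula sends each x to itself or to its
    parent, and induction along parents shows that it fixes every vertex. *)
Lemma det_parent_mx phi : \det (parent_mx phi) = (rooted phi)%:R.
Proof.
have [rphi|/forallPn[x0 Nx0]] := boolP (rooted phi); last first.
  (* The indicator of the states that never reach the cemetery is invariant
     under [phi], hence killed by I - N. *)
  pose lost o := (~~ fconnect (climb phi) o None)%:R : R.
  have lost_climb x : lost (Some x) = lost (phi x) by rewrite /lost fconnect_eqVf.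
  pose u := \col_i lost (Some (enum_val i)) : 'cV[R]_#|V|.
  have Mu0 : parent_mx phi *m u = 0.
    apply/colP => i; rewrite !mxE.
    under eq_bigr => j _ do rewrite !mxE mulrBl.
    rewrite sumrB (bigD1 i) //= eqxx mul1r big1 ?addr0; last first.
      by move=> j /negPf; rewrite eq_sym => ->; rewrite mul0r.
    rewrite lost_climb; case: (phi (enum_val i)) => [y|].
      rewrite (bigD1 (enum_rank y)) //= enum_rankK eqxx mul1r big1 ?addr0 ?subrr//.
      move=> j jy; rewrite (_ : _ == _ = false) ?mul0r//.
      by apply: contra_neqF jy => /eqP[->]; rewrite enum_valK.
    by rewrite big1 ?subr0 => [|j _]; rewrite ?mul0r// /lost connect0.
  have := mulmxA (\adj (parent_mx phi)) (parent_mx phi) u.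
  rewrite mul_adj_mx Mu0 mulmx0 => /esym/colP/(_ (enum_rank x0)).
  by rewrite mul_scalar_mx !mxE enum_rankK /lost Nx0 mulr1.
rewrite /determinant (bigD1 (1%g : {perm 'I_#|V|})) //= odd_perm1 expr0 mul1r.
rewrite [X in X + _]big1 => [|i _]; last first.
  by rewrite !mxE perm1 eqxx (negPf (rooted_irrefl _ rphi)) subr0.
rewrite big1 ?addr0// => s s1.
suff [i i0] : exists i, parent_mx phi i (s i) = 0.
  by rewrite (bigD1 i) //= i0 mul0r mulr0.
have [/existsP[i /eqP i0]|/existsPn sM] :=
    boolP [exists i, parent_mx phi i (s i) == 0]; first by exists i.
case/eqP: s1.
apply/perm.permP => i; rewrite perm1 -[i]enum_valK.
elim/(rooted_ind rphi): (enum_val i) => x IH.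
have := sM (enum_rank x); rewrite !mxE enum_rankK.
have [<-//|_] := eqVneq (enum_rank x) (s (enum_rank x)); rewrite sub0r oppr_eq0.
have [xs _|] := eqVneq (phi x) (Some (enum_val (s (enum_rank x)))); last by rewrite eqxx.
by have := IH _ xs; rewrite enum_valK => /perm_inj.
Qed.

(** The Leibniz formula with products over [V], which is where the parent maps
    live, instead of over the row indices. *)
Lemma det_leibniz_enum (M : 'M[R]_#|V|) :
  \det M = \sum_(s : {perm 'I_#|V|})
             (-1) ^+ s * \prod_x M (enum_rank x) (s (enum_rank x)).
Proof.
apply: eq_bigr => s _; congr (_ * _).
exact/(reindex (@enum_rank V))/onW_bij/enum_rank_bij.
Qed.

(** Row x of q + L is the sum, over the possible values o of phi x, of the weight
    of o times row x of the matrix I - N of [phi]; multilinearity of the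
    determinant in the rows gives one term per parent map. *)
Theorem matrix_forest w q :
  \det (q%:M + laplacian w) = \sum_(phi | rooted phi) parent_weight w q phi.
Proof.
rewrite [RHS]big_mkcond /=.
have -> : q%:M + laplacian w = \matrix_(i, j)
   \sum_(o : option V) oapp (w (enum_val i)) q o *
      ((i == j)%:R - (o == Some (enum_val j))%:R).
  apply/matrixP => i j; rewrite !mxE big_optionE /= subr0.
  under [in RHS]eq_bigr do rewrite mulrBr.
  rewrite sumrB -mulr_suml.
  have -> : \sum_y w (enum_val i) y * (Some y == Some (enum_val j))%:R =
      w (enum_val i) (enum_val j).
    rewrite (bigD1 (enum_val j)) //= eqxx mulr1 big1 ?addr0// => y yj.
    by rewrite (_ : _ == _ = false) ?mulr0//; apply: contra_neqF yj => /eqP[->].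
  by rewrite -mulr_natr; ring.
rewrite det_leibniz_enum.
pose c (s : {perm 'I_#|V|}) x o := oapp (w x) q o * ((enum_rank x == s (enum_rank x))%:R
  - (o == Some (enum_val (s (enum_rank x))))%:R).
transitivity (\sum_(s : {perm 'I_#|V|}) \sum_(phi : {ffun V -> option V})
    (-1) ^+ s * \prod_x c s x (phi x)).
  apply: eq_bigr => s _; rewrite -mulr_sumr -bigA_distr_bigA; congr (_ * _).
  by apply: eq_bigr => x _; rewrite !mxE enum_rankK.
rewrite exchange_big /=; apply: eq_bigr => phi _.
transitivity (parent_weight w q phi * \det (parent_mx phi)); last first.
  by rewrite det_parent_mx; case: ifP => _; rewrite ?mulr1 ?mulr0.
rewrite det_leibniz_enum mulr_sumr; apply: eq_bigr => s _.
rewrite big_split /= mulrCA; congr (_ * (_ * _)).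
by apply: eq_bigr => x _; rewrite mxE enum_rankK.
Qed.
End MatrixForest.

(** * Rank-one updates and resolvents of the Laplacian *)

(** Both sides are the determinant of the block matrix with rows (M, -u) and
    (v, 1), factored by eliminating either of its diagonal blocks. *)
Lemma det_add_rank1 (R : comUnitRingType) n (M : 'M[R]_n) (u : 'cV_n) (v : 'rV_n) :
  M \in unitmx ->
  \det (M + u *m v) = \det M * (1 + (v *m invmx M *m u) 0 0).
Proof.
move=> Mu; transitivity (\det (block_mx M (- u) v (1%:M : 'M[R]_1))).
  have -> : block_mx M (- u) v 1%:M =
      block_mx (M + u *m v) (- u) 0 1%:M *m block_mx 1%:M 0 v (1%:M : 'M[R]_1).
    by rewrite mulmx_block !mulmx1 !mulmx0 !mul1mx mulNmx addrK !add0r.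
  by rewrite det_mulmx det_ublock det_lblock !det1 !mulr1.
have -> : block_mx M (- u) v 1%:M =
    block_mx 1%:M 0 (v *m invmx M) 1%:M *m
    block_mx M (- u) 0 (1%:M + v *m invmx M *m u).
  rewrite mulmx_block !mulmx0 !mul1mx !mul0mx !addr0 mulmxKV// mulmxN.
  by rewrite [1%:M + _]addrC addKr.
by rewrite det_mulmx det_lblock det_ublock !det1 !mul1r det_mx11 !mxE eqxx.
Qed.

Section Resolvent.
Variables (R : realFieldType) (n : nat).
Implicit Types (N : 'M[R]_n) (b : 'cV[R]_n).

Definition psd N := forall v : 'cV[R]_n, 0 <= (v^T *m N *m v) 0 0.

(** With u and v the images of [b] under the resolvents at p and at q, the
    resolvent identity gives b^T u - b^T v = (q - p) v^T u, and
    u = v + (q - p) (p + N)^-1 v makes v^T u nonnegative. *)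
Lemma resolvent_form_antitone N b p q : N^T = N -> psd N ->
  0 <= p -> p <= q -> p%:M + N \in unitmx -> q%:M + N \in unitmx ->
  (b^T *m invmx (q%:M + N) *m b) 0 0 <= (b^T *m invmx (p%:M + N) *m b) 0 0.
Proof.
move=> symN psdN p0 pq; set S := p%:M + N; set T := q%:M + N => Su Tu.
have symS : S^T = S by rewrite /S linearD /= tr_scalar_mx symN.
have symT : T^T = T by rewrite /T linearD /= tr_scalar_mx symN.
have TE : T = S + (q - p)%:M.
  by rewrite /S /T raddfB /= addrAC [p%:M + _]addrC subrK.
pose u := invmx S *m b; pose v := invmx T *m b; pose r := invmx S *m v.
have Su_b : S *m u = b by rewrite mulKVmx.
have Tv_b : T *m v = b by rewrite mulKVmx.
have Sr_v : S *m r = v by rewrite mulKVmx.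
have uE : u = v + (q - p) *: r.
  rewrite /u -Tv_b TE mulmxDl mulmxDr mulKmx// mul_scalar_mx.
  by rewrite -scalemxAr.
have nnorm (z : 'cV[R]_n) : 0 <= (z^T *m z) 0 0.
  by rewrite mxE sumr_ge0// => i _; rewrite mxE -expr2 sqr_ge0.
have rSr : 0 <= (r^T *m S *m r) 0 0.
  rewrite /S mulmxDr mulmxDl mul_mx_scalar -scalemxAl mxE addr_ge0//.
  by rewrite mxE mulr_ge0.
have vr : 0 <= (v^T *m r) 0 0 by rewrite -Sr_v trmx_mul symS.
rewrite -!mulmxA -/u -/v -subr_ge0.
have -> : (b^T *m u) 0 0 - (b^T *m v) 0 0 = (q - p) * (v^T *m u) 0 0.
  have -> : (b^T *m v) 0 0 = (v^T *m S *m u) 0 0.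
    have tr1 (A : 'M[R]_1) : A 0 0 = A^T 0 0 by rewrite mxE.
    by rewrite tr1 trmx_mul trmxK -Su_b mulmxA.
  have -> : b^T = v^T *m T by rewrite -Tv_b trmx_mul symT.
  rewrite TE mulmxDr mulmxDl mul_mx_scalar -scalemxAl.
  by rewrite !mxE addrAC subrr add0r.
rewrite mulr_ge0 ?subr_ge0// uE mulmxDr -scalemxAr mxE addr_ge0//.
by rewrite mxE mulr_ge0 ?subr_ge0.
Qed.

End Resolvent.

Section LaplacianForm.
Variables (R : realFieldType) (V : finType).
Variables (w : V -> V -> R).
Hypotheses (symw : forall x y, w x y = w y x) (w_ge0 : forall x y, 0 <= w x y).

Lemma laplacian_sym : (laplacian w)^T = laplacian w.
Proof.
apply/matrixP => i j; rewrite !mxE symw eq_sym.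
by have [->|] := eqVneq; rewrite // !mul0r.
Qed.

(** Twice the quadratic form is the sum of w(x,y) (v_x - v_y)^2 over all ordered
    pairs. *)
Lemma laplacian_psd : psd (laplacian w).
Proof.
move=> v; pose W (i j : 'I_#|V|) := w (enum_val i) (enum_val j).
suff : 0 <= (v^T *m laplacian w *m v) 0 0 * 2 by rewrite pmulr_lge0.
suff -> : (v^T *m laplacian w *m v) 0 0 * 2 =
    \sum_i \sum_j W i j * (v i 0 - v j 0) ^+ 2.
  by do 2 (apply: sumr_ge0 => ? _); rewrite mulr_ge0 ?sqr_ge0 ?w_ge0.
have -> : (v^T *m laplacian w *m v) 0 0 =
    \sum_i \sum_j (W i j * v i 0 ^+ 2 - W i j * v i 0 * v j 0).
  rewrite -mulmxA mxE; apply: eq_bigr => i _; rewrite sumrB -!mulr_suml !mxE.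
  transitivity (v i 0 * \sum_j ((i == j)%:R * (\sum_k W i k) * v j 0 - W i j * v j 0)).
    congr (_ * _); apply: eq_bigr => j _; rewrite !mxE mulrBl; congr (_ * _ * _ - _).
    exact/(reindex (@enum_val V predT))/onW_bij/enum_val_bij.
  rewrite sumrB mulrBr; congr (_ - _).
    set S := \sum_k W i k; rewrite (bigD1 i) //= eqxx mul1r big1 ?addr0; first ring.
    by move=> j /negPf ji; rewrite eq_sym ji !mul0r.
  by rewrite mulr_sumr; apply: eq_bigr => j _; ring.
have -> : \sum_i \sum_j W i j * (v i 0 - v j 0) ^+ 2 =
    \sum_i \sum_j ((W i j * v i 0 ^+ 2 - W i j * v i 0 * v j 0) +
                   (W j i * v j 0 ^+ 2 - W j i * v j 0 * v i 0)).
  apply: eq_bigr => i _; apply: eq_bigr => j _.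
  have -> : W j i = W i j by exact: symw.
  ring.
under [in RHS]eq_bigr do rewrite big_split.
by rewrite big_split /= [X in _ = _ + X]exchange_big /= mulr_natr mulr2n.
Qed.

End LaplacianForm.

(** * Monotonicity of edge probabilities *)

(** Otherwise the quadratic would be negative for large t. *)
Lemma lead_coef_ge0 (R : realFieldType) (a b c : R) :
  (forall t, 0 < t -> 0 <= a + b * t + c * t ^+ 2) -> 0 <= c.
Proof.
move=> nonneg; rewrite leNgt; apply/negP => c0.
(* This choice gives c t = c - (|a| + |b|), so that (c t) t outweighs a + b t. *)
pose t := 1 + (`|a| + `|b|) / - c.
have t1 : 1 <= t by rewrite lerDl divr_ge0 ?addr_ge0 ?oppr_ge0// ltW.
have := nonneg t (lt_le_trans ltr01 t1); apply/negP; rewrite -ltNge.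
have tE : c * t = c - (`|a| + `|b|) by rewrite /t; field; rewrite lt_eqF.
have at_ : a <= `|a| * t by rewrite (le_trans (ler_norm a))// ler_peMr.
have bt : b * t <= `|b| * t by rewrite ler_wpM2r ?ler_norm// (le_trans ler01).
rewrite expr2 mulrA tE; apply: le_lt_trans (_ : c * t < 0); first by lra.
by rewrite nmulr_rlt0// (lt_le_trans ltr01).
Qed.

Section ForestSums.
Variables (R : realFieldType) (V : finType).
Implicit Types (phi : {ffun V -> option V}) (w : V -> V -> R) (p q t : R).
Implicit Types (e : V * V) (P : pred {ffun V -> option V}).

Definition has_edge e phi := adjacent phi e.1 e.2.

Definition forest_sum w q P := \sum_(phi | rooted phi && P phi) parent_weight w q phi.

(** The weight of an edge is rescaled in both directions, which keeps weights
    symmetric. *)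
Definition boost w e (c : R) x y :=
  if ((x, y) == e) || ((y, x) == e) then c * w x y else w x y.

Lemma parent_weight_ge0 w q phi : (forall x y, 0 <= w x y) -> 0 <= q ->
  0 <= parent_weight w q phi.
Proof. by move=> w0 q0; apply: prodr_ge0 => x _; case: (phi x) => [y|] /=. Qed.

Lemma forest_sum_ge0 w q P : (forall x y, 0 <= w x y) -> 0 <= q ->
  0 <= forest_sum w q P.
Proof. by move=> w0 q0; apply: sumr_ge0 => phi _; exact: parent_weight_ge0. Qed.

Lemma rooted_none : rooted [ffun _ : V => None].
Proof. by apply/forallP => x; rewrite (connect_trans (fconnect1 _ _))//= ffunE. Qed.

Lemma forest_sum_gt0 w q : (forall x y, 0 <= w x y) -> 0 < q ->
  0 < forest_sum w q predT.
Proof.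
move=> w0 q0; rewrite /forest_sum (bigD1 [ffun _ => None]) /=; last first.
  by rewrite rooted_none.
rewrite ltr_pwDl//; last first.
  by apply: sumr_ge0 => phi _; rewrite parent_weight_ge0// ltW.
by apply: prodr_gt0 => x _; rewrite ffunE.
Qed.

(** A rooted map uses an edge in at most one direction, so the factor [c] occurs
    at most once. *)
Lemma parent_weight_boost w e c q phi : rooted phi ->
  parent_weight (boost w e c) q phi =
  (if has_edge e phi then c else 1) * parent_weight w q phi.
Proof.
case: e => a b rphi.
have boostE x : oapp (boost w (a, b) c x) q (phi x) =
    (if (x == a) && (phi x == Some b) || (x == b) && (phi x == Some a) then c else 1)
    * oapp (w x) q (phi x).
  case: (phi x) => [y|] /=; last by rewrite !andbF mul1r.
  rewrite /boost !xpair_eqE [(y == a) && _]andbC !(inj_eq Some_inj).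
  by case: ifP => _; rewrite ?mul1r.
rewrite /parent_weight (eq_bigr _ (fun x _ => boostE x)) big_split /=.
congr (_ * _); rewrite /has_edge /adjacent /=.
have [ab|/eqP ab] /= := eqVneq (phi a) (Some b).
  rewrite (bigD1 a) //= ab !eqxx /= big1 ?mulr1// => x /negPf -> /=.
  have [->|] //= := eqVneq x b; case: eqP => // ba.
  by have := rooted_asym rphi ab; rewrite ba eqxx.
have [ba|/eqP ba] /= := eqVneq (phi b) (Some a).
  rewrite (bigD1 b) //= ba !eqxx orbT big1 ?mulr1// => x /negPf -> /=.
  by rewrite orbF; case: eqP => //= ->; case: eqP.
rewrite big1// => x _.
by case: ifP => // /orP[] /andP[/eqP -> /eqP].
Qed.

(** Forest sums are affine functions of the weight of an edge; the slope is the
    forest sum restricted to the forests that use it. *)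
Lemma forest_sum_boost w e t q P :
  forest_sum (boost w e (1 + t)) q P =
  forest_sum w q P + t * forest_sum w q (fun phi => has_edge e phi && P phi).
Proof.
rewrite /forest_sum mulr_sumr [X in _ = _ + X]big_mkcond /=.
rewrite [LHS]big_mkcond [X in _ = X + _]big_mkcond -big_split; apply: eq_bigr => phi _ /=.
have [rphi|] /= := boolP (rooted phi); last by rewrite addr0.
case: (P phi); rewrite ?andbF ?andbT ?addr0//.
by rewrite parent_weight_boost//; case: ifP => _; ring.
Qed.

Lemma boost_sym w e c : (forall x y, w x y = w y x) ->
  forall x y, boost w e c x y = boost w e c y x.
Proof. by move=> symw x y; rewrite /boost orbC symw. Qed.

Lemma boost_ge0 w e c : (forall x y, 0 <= w x y) -> 0 <= c ->
  forall x y, 0 <= boost w e c x y.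
Proof. by move=> w0 c0 x y; rewrite /boost; case: ifP => // _; rewrite mulr_ge0. Qed.

(** The difference of the indicators of the two endpoints. *)
Definition edge_vec e : 'cV[R]_#|V| :=
  \col_i ((enum_val i == e.1)%:R - (enum_val i == e.2)%:R).

Lemma laplacian_boost w e t : (forall x y, w x y = w y x) ->
  laplacian (boost w e (1 + t)) =
  laplacian w + (t * w e.1 e.2) *: edge_vec e *m (edge_vec e)^T.
Proof.
case: e => a b symw; apply/matrixP => i j.
have boostE x y : boost w (a, b) (1 + t) x y = w x y + t * w a b *
    ((x == a) && (y == b) || (x == b) && (y == a))%:R.
  rewrite /boost !xpair_eqE [(y == a) && _]andbC.
  case: ifP => [|_]; last by rewrite mulr0 addr0.
  by case/orP => /andP[/eqP-> /eqP->]; rewrite ?[w b a]symw mulr1n; ring.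
rewrite !mxE big_ord1 !mxE boostE (eq_bigr _ (fun y _ => boostE _ y)) big_split /= -mulr_sumr.
have -> : (i == j) = (enum_val i == enum_val j :> V) by rewrite (inj_eq enum_val_inj).
move: (enum_val i) (enum_val j) => x y.
have sum1 (z : V) : \sum_y (y == z)%:R = 1 :> R.
  by rewrite (bigD1 z) //= eqxx big1 ?addr0// => u /negPf ->.
have -> : \sum_z ((x == a) && (z == b) || (x == b) && (z == a))%:R =
    (x == a)%:R + ((x == b) && (a != b))%:R :> R.
  have [->|xa] /= := eqVneq x a; last first.
    rewrite add0r; have [xb|xb] /= := eqVneq x b; last by rewrite big1.
    by rewrite [a == b]eq_sym -xb xa sum1.
  rewrite -[true%:R](sum1 b).
  by have [->|_] /= := eqVneq a b; rewrite ?eqxx addr0;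
    apply: eq_bigr => z _; rewrite ?orbb ?orbF.
(* The Laplacian of unit weights on both directions of the edge is b b^T; for
   a loop both are zero. *)
have key : (x == y)%:R * ((x == a)%:R + ((x == b) && (a != b))%:R)
    - ((x == a) && (y == b) || (x == b) && (y == a))%:R =
    ((x == a)%:R - (x == b)%:R) * ((y == a)%:R - (y == b)%:R) :> R.
  have [->|xy] := eqVneq x y.
    have [->|ab] := eqVneq a b; first by case: (y == b); rewrite /=; ring.
    have [->|ya] := eqVneq y a; first by rewrite (negPf ab) /=; ring.
    by case: (y == b); rewrite /=; ring.
  have [xa|xa] := eqVneq x a.
    rewrite -xa [y == x]eq_sym (negPf xy) /= andbF orbF.
    have [xb|_] := eqVneq x b; first by rewrite -xb eq_sym (negPf xy) /=; ring.
    by case: (y == b); rewrite /=; ring.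
  have [xb|_] /= := eqVneq x b; last by ring.
  by rewrite -xb [y == x]eq_sym (negPf xy) /=; case: (y == a); rewrite /=; ring.
move: key => /(canRL (subrK _)) /(congr1 ( *%R (t * w a b))) key.
by rewrite mulrDr [_ * (t * w a b * _)]mulrCA key; ring.
Qed.

Lemma forest_sum_det w q :
  forest_sum w q predT = \det (q%:M + laplacian w).
Proof. by rewrite matrix_forest; apply: eq_bigl => phi; rewrite andbT. Qed.

Lemma forest_sum_eq w q P P' : P =1 P' -> forest_sum w q P = forest_sum w q P'.
Proof. by move=> PP'; apply: eq_bigl => phi; rewrite PP'. Qed.

Section SymmetricWeights.
Variables w : V -> V -> R.
Hypotheses (symw : forall x y, w x y = w y x) (w_ge0 : forall x y, 0 <= w x y).

Lemma forest_mx_unit q : 0 < q -> q%:M + laplacian w \in unitmx.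
Proof.
by move=> q0; rewrite unitmxE unitfE -forest_sum_det gt_eqF// forest_sum_gt0.
Qed.

(** Doubling the weight of [e] counts the forests through [e] twice.  By the
    rank-one update formula the increment of the partition function, relative to
    its value, is w(e) times the effective resistance across [e] in the network
    killed at rate [q]. *)
Lemma forest_sum_edge q e : 0 < q ->
  forest_sum w q (has_edge e) = forest_sum w q predT *
    (w e.1 e.2 * ((edge_vec e)^T *m invmx (q%:M + laplacian w) *m edge_vec e) 0 0).
Proof.
move=> q0; have /esym/(canRL (addKr _)) := forest_sum_boost w e 1 q predT.
rewrite mul1r (forest_sum_eq _ _ (P' := has_edge e)); last by move=> phi; rewrite andbT.
move=> ->; rewrite !forest_sum_det laplacian_boost// mul1r addrA det_add_rank1 ?forest_mx_unit//.
by rewrite mulrDr mulr1 addKr -scalemxAr [X in _ * X = _]mxE.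
Qed.

Lemma single_edge_antitone p q e : 0 < p -> p <= q ->
  forest_sum w q (has_edge e) * forest_sum w p predT <=
  forest_sum w p (has_edge e) * forest_sum w q predT.
Proof.
move=> p0 pq; have q0 := lt_le_trans p0 pq; rewrite !forest_sum_edge//.
rewrite mulrAC [X in _ <= X]mulrAC [X in _ <= X * _]mulrC.
apply: ler_wpM2l; first by rewrite mulr_ge0 ?forest_sum_ge0 ?ltW.
apply: ler_wpM2l => //.
apply: resolvent_form_antitone => //; rewrite ?forest_mx_unit ?ltW//.
- exact: laplacian_sym.
- exact: laplacian_psd.
Qed.

End SymmetricWeights.

Definition has_edges (s : seq (V * V)) phi := all (has_edge^~ phi) s.

(** Cross-multiplied form of: the conditional probability of [e] given the edges
    [s] does not increase from p to q.  The induction on [s] applies the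
    hypothesis to the weights in which the new edge [c] is multiplied by 1 + t.
    Both sides are then quadratic in t, and the coefficients of t^2 only involve
    the forests that use [c]. *)
Lemma one_more_edge_antitone s w p q e :
  (forall x y, w x y = w y x) -> (forall x y, 0 <= w x y) -> 0 < p -> p <= q ->
  forest_sum w q (has_edges (e :: s)) * forest_sum w p (has_edges s) <=
  forest_sum w p (has_edges (e :: s)) * forest_sum w q (has_edges s).
Proof.
move=> symw w0 p0 pq; elim: s w symw w0 => [|c s IHs] w symw w0.
  have eE r : forest_sum w r (has_edges [:: e]) = forest_sum w r (has_edge e).
    by apply: forest_sum_eq => phi; rewrite /has_edges /= andbT.
  by rewrite !eE; exact: single_edge_antitone.
rewrite -subr_ge0.
(* The new edge [c] is moved in front, where [forest_sum_boost] produces it. *)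
have swapE r : forest_sum w r (has_edges [:: e, c & s]) =
    forest_sum w r (fun phi => has_edge c phi && has_edges (e :: s) phi).
  by apply: forest_sum_eq => phi; rewrite /has_edges /= andbCA.
rewrite !swapE.
pose Z r s' := forest_sum w r (has_edges s').
pose Zc r s' := forest_sum w r (fun phi => has_edge c phi && has_edges s' phi).
apply: (@lead_coef_ge0 _ (Z p (e :: s) * Z q s - Z q (e :: s) * Z p s)
  (Z p (e :: s) * Zc q s + Zc p (e :: s) * Z q s
   - (Z q (e :: s) * Zc p s + Zc q (e :: s) * Z p s))) => t t0.
have t1 : 0 <= 1 + t by rewrite addr_ge0 ?ltW.
have := IHs _ (boost_sym c (1 + t) symw) (boost_ge0 c w0 t1).
rewrite !forest_sum_boost -subr_ge0; congr (0 <= _).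
rewrite /Z /Zc; ring.
Qed.

(** The probability of an edge list is a telescoping product of conditional
    probabilities of one more edge.  When the probability of the tail vanishes
    at p it vanishes at q too, and so does that of the longer list. *)
Lemma edges_antitone s w p q :
  (forall x y, w x y = w y x) -> (forall x y, 0 <= w x y) -> 0 < p -> p <= q ->
  forest_sum w q (has_edges s) * forest_sum w p predT <=
  forest_sum w p (has_edges s) * forest_sum w q predT.
Proof.
move=> symw w0 p0 pq; have q0 := lt_le_trans p0 pq.
have Z0 r P : 0 < r -> 0 <= forest_sum w r P by move=> r0; rewrite forest_sum_ge0 ?ltW.
elim: s => [|e s IHs]; first by rewrite mulrC.
have step := one_more_edge_antitone s e symw w0 p0 pq.
have [Zp0|Zp_neq0] := eqVneq (forest_sum w p (has_edges s)) 0.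
  have Zq0 : forest_sum w q (has_edges s) = 0.
    move: IHs; rewrite Zp0 mul0r pmulr_lle0 ?forest_sum_gt0// => Zq0.
    by apply/eqP; rewrite eq_le Zq0 Z0.
  have : forest_sum w q (has_edges (e :: s)) = 0.
    apply/eqP; rewrite eq_le Z0// andbT -Zq0 /forest_sum.
    rewrite big_mkcond [X in _ <= X]big_mkcond; apply: ler_sum => phi _ /=.
    case: (rooted phi) => //=; case: (has_edge e phi) => //=.
    by case: ifP => // _; rewrite parent_weight_ge0 ?ltW.
  by move=> ->; rewrite mul0r mulr_ge0 ?Z0.
have Zp_gt0 : 0 < forest_sum w p (has_edges s) by rewrite lt_neqAle eq_sym Zp_neq0 Z0.
rewrite -(ler_pM2r Zp_gt0) mulrAC.
apply: (le_trans (ler_wpM2r (Z0 p predT p0) step)).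
rewrite -!mulrA ler_wpM2l ?Z0// [X in _ <= X]mulrC; exact: IHs.
Qed.
End ForestSums.

(** * Connection events as disjoint unions of path events *)

Section SimplePaths.
Variables (V : finType) (phi : {ffun V -> option V}).
Hypothesis rphi : rooted phi.

Lemma adjacent_sym : symmetric (adjacent phi).
Proof. by move=> x y; rewrite /adjacent /= orbC. Qed.

(** Every edge of a forest is a bridge: for an edge from a to its parent b, the
    set of descendants of a contains a but not b, and no other edge of the forest
    crosses its boundary. *)
Lemma adjacent_bridge a b : adjacent phi a b ->
  exists D : pred V, D a != D b /\
    forall x y, adjacent phi x y -> D x != D y -> (x == a) && (y == b) || (x == b) && (y == a).
Proof.
wlog ab : a b / phi a = Some b => [wl|_].
  case/orP => /eqP ab; first by apply: (wl) => //; rewrite /adjacent /= ab eqxx.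
  have [|D [Dba Dcross]] := wl b a ab; first by rewrite /adjacent /= ab eqxx.
  exists D; rewrite eq_sym; split=> // x y xy Dxy.
  by rewrite orbC Dcross.
pose D z := fconnect (climb phi) (Some z) (Some a).
have DE x y : phi x = Some y -> D x = (x == a) || D y.
  by move=> xy; rewrite /D fconnect_eqVf /= xy.
have Db : D b = false by apply/negbTE/rooted_no_return.
have cross x y : phi x = Some y -> D x != D y -> (x == a) && (y == b).
  move=> xy; rewrite (DE _ _ xy); have [xa|] := eqVneq x a; last by rewrite eqxx.
  by move: xy; rewrite xa ab => -[->]; rewrite eqxx.
exists D; split; first by rewrite Db (DE a b ab) eqxx.
move=> x y /orP[] /eqP xy; first by move/(cross _ _ xy) ->.
by rewrite eq_sym => /(cross _ _ xy); rewrite andbC => ->; rewrite orbT.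
Qed.

(** Suppose two simple paths leave x along different edges.  The first one crosses
    the bridge formed by its first edge and never comes back to x; the second one
    never uses that edge.  So their endpoints lie on different sides of it. *)
Lemma simple_path_unique x p q :
  path (adjacent phi) x p -> path (adjacent phi) x q ->
  uniq (x :: p) -> uniq (x :: q) -> last x p = last x q -> p = q.
Proof.
(* A simple path that ends where it starts is empty. *)
have nil_loop z r : uniq (z :: r) -> z = last z r -> r = [::].
  by case: r => // a r /andP[+ _] zE; rewrite {1}zE /= mem_last.
elim: p x q => [|a p IHp] x [|b q] //; first by move=> _ _ _ uq /nil_loop->.
  by move=> _ _ up _ /esym/nil_loop ->.
move=> /= /andP[xa pp] /andP[xb pq] up uq lpq.
have [ab|ab] := eqVneq a b.
  rewrite ab in pp up lpq *; congr (_ :: _); apply: (IHp b) => //.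
  - by case/andP: up.
  - by case/andP: uq.
have [D [Dxa cross]] := adjacent_bridge xa.
have D_const z r : path (adjacent phi) z r -> x \notin z :: r -> D (last z r) = D z.
  elim: r z => //= c r IHr z /andP[zc pr]; rewrite in_cons negb_or => /andP[xz xr].
  rewrite IHr//; apply/eqP/negPn/negP; rewrite eq_sym => /(cross _ _ zc).
  move: xr; rewrite in_cons negb_or => /andP[xc _].
  by rewrite [z == x]eq_sym (negPf xz) [c == x]eq_sym (negPf xc) andbF.
have Dlast_a : D (last a p) = D a by apply: D_const => //; case/andP: up.
have Dlast_b : D (last b q) = D b by apply: D_const => //; case/andP: uq.
have : D x != D b by rewrite -Dlast_b -lpq Dlast_a.
move/(cross _ _ xb); rewrite eqxx [b == a]eq_sym (negPf ab) /=.
by case/andP: up; rewrite in_cons negb_or => /andP[/negPf-> _].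
Qed.

Lemma path_has_edges x p :
  path (adjacent phi) x p = has_edges (zip (x :: p) p) phi.
Proof. by elim: p x => //= a p IHp x; rewrite IHp. Qed.

(** A simple path visits each vertex at most once, whence the bound on lengths
    that makes the index set finite. *)
Lemma same_tree_sum (R : nzSemiRingType) x y :
  (connect (adjacent phi) x y)%:R =
  \sum_(p : #|V|.-bseq V | uniq (x :: p) && (last x p == y))
     (path (adjacent phi) x p)%:R :> R.
Proof.
have [/connectP[p0 p0path yE]|Nxy] := boolP (connect _ _ _); last first.
  rewrite big1// => p /andP[_ /eqP lp]; case pp: (path _ _ _) => //.
  by case/negP: Nxy; apply/connectP; exists p.
case/shortenP: p0path yE => p pp up _ yE.
have sp : (size p <= #|V|)%N by have := max_card [in x :: p]; rewrite (card_uniqP up) => /ltnW.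
rewrite (bigD1 (Bseq sp)) /=; last by rewrite yE eqxx andbT.
rewrite pp big1 ?addr0// => r /andP[/andP[ur /eqP lr] rp].
case pr: (path _ _ _) => //; case/eqP: rp; apply/val_inj => /=.
by apply: (@simple_path_unique x) => //; rewrite lr.
Qed.

End SimplePaths.

Section Connection.
Variables (R : realFieldType) (V : finType).
Implicit Types (w : V -> V -> R) (x y : V).

Definition linked x y : pred {ffun V -> option V} :=
  fun phi => connect (adjacent phi) x y.

(** A forest contains at most one simple path from x to y, so the path events are
    disjoint. *)
Lemma linked_sum w q x y :
  forest_sum w q (linked x y) =
  \sum_(p : #|V|.-bseq V | uniq (x :: p) && (last x p == y))
     forest_sum w q (has_edges (zip (x :: p) p)).
Proof.
transitivity (\sum_(phi | rooted phi) \sum_(p : #|V|.-bseq V | uniq (x :: p) && (last x p == y))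
    (has_edges (zip (x :: p) p) phi)%:R * parent_weight w q phi).
  rewrite /forest_sum big_mkcondr; apply: eq_bigr => phi rphi.
  rewrite -mulr_suml.
  under eq_bigr => p _ do rewrite -path_has_edges.
  by rewrite -same_tree_sum// /linked; case: ifP => _; rewrite ?mul1r ?mul0r.
rewrite exchange_big; apply: eq_bigr => p _ /=.
rewrite /forest_sum [RHS]big_mkcondr; apply: eq_bigr => phi _.
by case: ifP => _; rewrite ?mul1r ?mul0r.
Qed.

(** Termwise from [edges_antitone], as the event is a disjoint union of events
    that prescribe the edges of a path. *)
Lemma linked_antitone w p q x y :
  (forall x y, w x y = w y x) -> (forall x y, 0 <= w x y) -> 0 < p -> p <= q ->
  forest_sum w q (linked x y) * forest_sum w p predT <=
  forest_sum w p (linked x y) * forest_sum w q predT.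
Proof.
move=> symw w0 p0 pq; rewrite !linked_sum !mulr_suml.
by apply: ler_sum => r _; exact: edges_antitone.
Qed.

End Connection.

(** * Forests with fewer roots *)

Section FewerRoots.
Variables (V : finType) (pw : rel V).
Hypothesis pw_sym : symmetric pw.
Implicit Types (phi : {ffun V -> option V}) (u v x y z : V).

Definition roots_of phi := [set x | phi x == None].

Definition redirect phi u v : {ffun V -> option V} :=
  [ffun x => if x == u then Some v else phi x].

(** Orbits that avoid [u] do not see the change. *)
Lemma redirect_iter phi u v z k :
  ~~ fconnect (climb phi) (Some z) (Some u) ->
  iter k (climb (redirect phi u v)) (Some z) = iter k (climb phi) (Some z).
Proof.
move=> Nzu; elim: k => //= k ->; case kz: (iter k _ _) => [x|//] /=; rewrite ffunE.
by case: eqP => // xu; case/negP: Nzu; rewrite -xu -kz fconnect_iter.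
Qed.

Lemma redirect_fconnect phi u v z o :
  ~~ fconnect (climb phi) (Some z) (Some u) ->
  fconnect (climb (redirect phi u v)) (Some z) o = fconnect (climb phi) (Some z) o.
Proof.
move=> Nzu; apply/idP/idP => /iter_findex <-.
  by rewrite redirect_iter// fconnect_iter.
by rewrite -(redirect_iter v _ Nzu) fconnect_iter.
Qed.

(** Cutting [u] from its parent and attaching it to a vertex that is not below
    [u] creates no cycle. *)
Lemma redirect_rooted phi u v : rooted phi ->
  ~~ fconnect (climb phi) (Some v) (Some u) -> rooted (redirect phi u v).
Proof.
move=> rphi Nvu; apply/forallP => x; elim/(rooted_ind rphi): x => x IH.
rewrite fconnect_eqVf /= ffunE; have [_|_] := eqVneq x u.
  by rewrite redirect_fconnect//; move/forallP: rphi.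
by case xy: (phi x) => [y|]; [exact: IH | rewrite connect0].
Qed.

(** Induction on the depth of [u].  If [u] is a root, attaching it to [v] removes
    a root.  Otherwise attaching [u] to [v] keeps the number of roots and leaves
    the former parent u' of [u] in another tree than [u]; the edge from u' to [u]
    is again usable by symmetry, and u' is one step closer to its root.
    Iterating reverses the path from [u] to its root. *)
Lemma redirect_fewer_roots phi u v : rooted phi ->
  (forall x y, phi x = Some y -> pw x y) -> pw u v ->
  (forall z, fconnect (climb phi) (Some u) (Some z) ->
             ~~ fconnect (climb phi) (Some v) (Some z)) ->
  exists phi', [/\ rooted phi', (forall x y, phi' x = Some y -> pw x y)
                 & (#|roots_of phi'| < #|roots_of phi|)%N].
Proof.
move=> rphi; have := iter_findex (forallP rphi u).
move: (findex _ _ _) => k; elim: k phi u v rphi => [//|k IHk] phi u v rphi.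
rewrite iterSr /= => ku pwphi uv disj.
have Nvu : ~~ fconnect (climb phi) (Some v) (Some u) by exact/disj/connect0.
pose phi1 := redirect phi u v.
have rphi1 : rooted phi1 by exact: redirect_rooted.
have pwphi1 x y : phi1 x = Some y -> pw x y.
  by rewrite ffunE; case: eqP => [->|_]; [move=> [<-] | exact: pwphi].
case uu: (phi u) ku => [u'|] ku; last first.
  exists phi1; split=> //; apply: proper_card; apply/properP; split.
    by apply/fintype.subsetP => x; rewrite !inE ffunE; case: ifP.
  by exists u; rewrite !inE ?ffunE ?uu ?eqxx.
have Nu'u : ~~ fconnect (climb phi) (Some u') (Some u) by exact: rooted_no_return.
have pw_u'u : pw u' u by rewrite pw_sym; exact: pwphi.
have ku1 : iter k (climb phi1) (Some u') = None.
  by rewrite redirect_iter.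
have disj1 z : fconnect (climb phi1) (Some u') (Some z) ->
    ~~ fconnect (climb phi1) (Some u) (Some z).
  rewrite redirect_fconnect// => u'z; rewrite fconnect_eqVf /= ffunE eqxx.
  rewrite redirect_fconnect// negb_or disj ?andbT.
    by apply: contraNN Nu'u => /eqP[->].
  by rewrite fconnect_eqVf /= uu u'z orbT.
have [phi' [r' pw' lt']] := IHk phi1 u' u rphi1 ku1 pwphi1 pw_u'u disj1.
exists phi'; split=> //; rewrite (_ : roots_of phi = roots_of phi1)//.
by apply/setP => x; rewrite !inE ffunE; have [->|//] := eqVneq x u; rewrite uu.
Qed.

(** A chain of [pw]-edges between different trees contains an edge (u, v) that
    joins different trees, and the orbits of its endpoints cannot meet. *)
Lemma fewer_roots phi x y : rooted phi ->
  (forall x y, phi x = Some y -> pw x y) -> connect pw x y ->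
  ~~ connect (adjacent phi) x y ->
  exists phi', [/\ rooted phi', (forall x y, phi' x = Some y -> pw x y)
                 & (#|roots_of phi'| < #|roots_of phi|)%N].
Proof.
move=> rphi pwphi xy Nxy.
have [u [v [uv Nuv]]] : exists u v, pw u v /\ ~~ connect (adjacent phi) u v.
  have [/forallP all_uv|/forallPn[u /forallPn[v]]] :=
    boolP [forall u, forall v, pw u v ==> connect (adjacent phi) u v].
    case/negP: Nxy; apply: connect_sub xy => u v uv.
    by have /forallP/(_ v)/implyP/(_ uv) := all_uv u.
  by rewrite negb_imply => /andP[uv Nuv]; exists u, v.
have csym := sym_connect_sym (adjacent_sym phi).
have climb_connect a b : fconnect (climb phi) (Some a) (Some b) ->
    connect (adjacent phi) a b.
  move=> /iter_findex; move: (findex _ _ _) => k; elim: k a => [a [->]|k IHk a].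
    exact: connect0.
  rewrite iterSr /=; case ac: (phi a) => [c|]; last by rewrite iter_climb_None.
  move=> /IHk; apply: connect_trans; apply: connect1.
  by rewrite /adjacent /= ac eqxx.
apply: (redirect_fewer_roots rphi pwphi uv) => z uz; apply: contra Nuv => vz.
by rewrite (connect_trans (climb_connect _ _ uz))// csym climb_connect.
Qed.

End FewerRoots.

(** * Translation between forests and parent maps *)

Section ForestsAsParentMaps.
Variable V : finType.
Implicit Types (phi : {ffun V -> option V}) (F : {set V * V}) (x y : V).

Definition graph_of phi : {set V * V} := [set e | phi e.1 == Some e.2].

(** For sets with several edges out of x the choice of the parent is arbitrary;
    for forests it is forced. *)
Definition parent_of F : {ffun V -> option V} := [ffun x => [pick y | (x, y) \in F]].

Lemma in_graph_of phi x y : ((x, y) \in graph_of phi) = (phi x == Some y).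
Proof. by rewrite inE. Qed.

Lemma graph_ofK : cancel graph_of parent_of.
Proof.
move=> phi; apply/ffunP => x; rewrite ffunE; case: pickP => [y|noy].
  by rewrite in_graph_of => /eqP.
case xy: (phi x) => [y|//].
by have := noy y; rewrite in_graph_of xy eqxx.
Qed.

Lemma graph_of_out phi x :
  (#|[set y | (x, y) \in graph_of phi]| <= 1)%N.
Proof.
case xy: (phi x) => [y|].
  rewrite (_ : [set _ | _] = [set y]%SET) ?cards1//.
  by apply/setP => z; rewrite !inE /= xy (inj_eq Some_inj) eq_sym.
rewrite (_ : [set _ | _] = finset.set0) ?cards0//.
by apply/setP => z; rewrite !inE /= xy.
Qed.

Lemma acyclic_graph_of phi : acyclic (graph_of phi) <-> rooted phi.
Proof.
rewrite rooted_acyclic /acyclic.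
have E c : ucycle (edge_rel (graph_of phi)) c = ucycle [rel x y | phi x == Some y] c.
  rewrite /ucycle; congr (is_true (_ && _)).
  by apply: eq_cycle => x y; rewrite /edge_rel /= in_graph_of.
by split=> nocyc [c c0 cyc]; apply: nocyc; exists c; rewrite // ?E// -E.
Qed.

Lemma different_trees_graph_of phi x y :
  different_trees (graph_of phi) x y = ~~ connect (adjacent phi) x y.
Proof.
congr (~~ _); apply: eq_connect => u v.
by rewrite /edge_rel /= !in_graph_of.
Qed.

Lemma forest_roots_graph_of phi : forest_roots (graph_of phi) = roots_of phi.
Proof.
apply/setP => x; rewrite !inE; apply/forallP/eqP => [noy|xN y].
  by case xy: (phi x) => [y|//]; have := noy y; rewrite in_graph_of xy eqxx.
by rewrite in_graph_of xN.
Qed.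

Variables (R : realType) (G : wdigraph R V).

Lemma graph_of_forests phi :
  (graph_of phi \in forests G) = (graph_of phi \subset edges G) && rooted phi.
Proof.
rewrite inE (_ : [forall x, _] = true); last by apply/forallP => x; exact: graph_of_out.
by congr (_ && _); apply/asboolP/idP => /acyclic_graph_of.
Qed.

Lemma forests_graph_of F : F \in forests G -> graph_of (parent_of F) = F.
Proof.
rewrite inE => /and3P[_ /forallP out _]; apply/setP => -[x y].
rewrite in_graph_of ffunE; case: pickP => [z xz|->//].
apply/eqP/idP => [[<-]//|xy]; congr Some.
by have /card_le1_eqP := out x; apply; rewrite inE.
Qed.

(** Extending the weight by zero off the edges lets sums range over all rooted
    maps. *)
Definition edge_weight x y : R :=
  if (x, y) \in edges G then weight G (x, y) else 0.

Lemma edge_weight_ge0 x y : 0 <= edge_weight x y.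
Proof. by rewrite /edge_weight; case: ifP => // /weight_ge0. Qed.

Lemma edge_weight_sym : symmetric_graph G ->
  forall x y, edge_weight x y = edge_weight y x.
Proof.
move=> symG x y; rewrite /edge_weight.
case: ifPn => [/symG[-> ->]//|Nxy]; case: ifPn => // /symG[yx _].
by rewrite yx in Nxy.
Qed.

Lemma parent_weight_graph_of q phi : graph_of phi \subset edges G ->
  parent_weight edge_weight q phi =
  q ^+ #|forest_roots (graph_of phi)| * forest_weight G (graph_of phi).
Proof.
move=> /fintype.subsetP sub; rewrite forest_roots_graph_of.
have -> : q ^+ #|roots_of phi| = \prod_x (if phi x == None then q else 1).
  by rewrite -big_mkcond /= -prodr_const; apply: eq_bigl => x; rewrite inE.
have -> : forest_weight G (graph_of phi) =
    \prod_x \prod_(y | phi x == Some y) weight G (x, y).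
  rewrite /forest_weight pair_big_dep /=; apply: eq_big => [[x y]|[x y] _//].
  by rewrite in_graph_of.
rewrite -big_split; apply: eq_bigr => x _ /=; case xy: (phi x) => [y|] /=.
  rewrite mul1r (big_pred1 y) => [|z]; last by rewrite /= (inj_eq Some_inj) eq_sym.
  by rewrite /edge_weight sub// in_graph_of xy.
by rewrite big_pred0 ?mulr1.
Qed.

Lemma parent_weight_not_sub q phi : ~~ (graph_of phi \subset edges G) ->
  parent_weight edge_weight q phi = 0.
Proof.
move=> /fintype.subsetPn[[x y]]; rewrite in_graph_of => /eqP xy Nxy.
by rewrite /parent_weight (bigD1 x) //= xy /= /edge_weight (negPf Nxy) mul0r.
Qed.

Lemma sum_forests q (P : pred {set V * V}) :
  \sum_(F in forests G | P F) q ^+ #|forest_roots F| * forest_weight G F =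
  forest_sum edge_weight q (P \o graph_of).
Proof.
rewrite (reindex_onto graph_of parent_of) => [|F /andP[FG _]]; last exact: forests_graph_of.
rewrite /forest_sum [RHS](bigID (fun phi => graph_of phi \subset edges G)) /=.
rewrite [X in _ = _ + X]big1 ?addr0 => [|phi /andP[_ ?]]; last exact: parent_weight_not_sub.
apply: eq_big => [phi|phi]; rewrite graph_ofK eqxx graph_of_forests ?andbT.
  by case: (_ \subset _); rewrite ?andbF ?andbT/=.
by case/andP => /andP[sub _] _; rewrite parent_weight_graph_of.
Qed.

Lemma forest_probE q P : 0 < q -> forest_prob G q P =
  forest_sum edge_weight q (P \o graph_of) / forest_sum edge_weight q predT.
Proof.
move=> q0; rewrite -sum_forests /forest_prob mulr_suml; apply: eq_bigr => F _.
rewrite /forest_law gt_eqF// /gibbs; congr (_ / _).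
by rewrite -(sum_forests q predT); apply: eq_bigl => F'; rewrite andbT.
Qed.

End ForestsAsParentMaps.

(** * The law of the random forest and its limits *)

Section RandomForest.
Local Open Scope classical_set_scope.
Variables (R : realType) (V : finType) (G : wdigraph R V).
Implicit Types (P : pred {set V * V}) (F : {set V * V}) (x y : V).

Lemma forest_prob_gibbs q P : 0 < q ->
  forest_prob G q P = \sum_(F in forests G | P F) gibbs G q F.
Proof.
by move=> q0; apply: eq_bigr => F _; rewrite /forest_law gt_eqF.
Qed.

Lemma gibbs_ge0 q F : 0 < q -> F \in forests G -> 0 <= gibbs G q F.
Proof.
move=> q0 FG; rewrite /gibbs divr_ge0 ?mulr_ge0 ?exprn_ge0 ?forest_weight_ge0 ?ltW//.
exact: partition_fun_gt0.
Qed.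

Lemma forest_prob_cvg0 P : forest_prob G q P @[q --> 0^'+] --> forest_prob G 0 P.
Proof.
have cvg_gibbs : (\sum_(F in forests G | P F) gibbs G q F) @[q --> 0^'+] --> forest_prob G 0 P.
  apply: cvg_big => [|F /andP[FG _]]; first exact: add_continuous.
  by rewrite /forest_law eqxx; exact: gibbs_cvg0.
apply: cvg_trans cvg_gibbs; apply: near_eq_cvg; near=> q.
by rewrite forest_prob_gibbs.
Unshelve. all: by end_near. Qed.

Lemma forest_prob_continuous (q : R) P : 0 < q ->
  forest_prob G q' P @[q' --> q] --> forest_prob G q P.
Proof.
move=> q0; have cZ : continuous (partition_fun G).
  move=> s; apply: cvg_big => [|F _]; first exact: add_continuous.
  by apply: cvgM; [exact: exprn_continuous | exact: cvg_cst].
have cvg_gibbs : (\sum_(F in forests G | P F) gibbs G q' F) @[q' --> q] --> forest_prob G q P.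
  rewrite forest_prob_gibbs//; apply: cvg_big => [|F _]; first exact: add_continuous.
  apply: cvgM; last by apply: cvgV; [rewrite gt_eqF// partition_fun_gt0 | exact: cZ].
  by apply: cvgM; [exact: exprn_continuous | exact: cvg_cst].
apply: cvg_trans cvg_gibbs; apply: near_eq_cvg; near=> q'.
rewrite forest_prob_gibbs//; near: q'; exact: lt_nbhsr.
Unshelve. all: by end_near. Qed.

Lemma forest_prob_within_continuous P :
  {within `[0, +oo[, continuous (forest_prob G ^~ P)}.
Proof.
apply/continuous_within_itvcyP; split; last exact: forest_prob_cvg0.
by move=> q; rewrite in_itv /= andbT => q0; exact: forest_prob_continuous.
Qed.

Lemma forest_prob_le1 q P : 0 < q -> forest_prob G q P <= 1.
Proof.
move=> q0; rewrite forest_prob_gibbs// -(gibbs_sum1 G q0) big_mkcondr.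
by apply: ler_sum => F FG; case: ifP => // _; exact: gibbs_ge0.
Qed.

(** The law at 0 is the limit of the laws at s > 0. *)
Lemma antitone_extends0 P :
  (forall p q : R, 0 < p -> p <= q -> forest_prob G q P <= forest_prob G p P) ->
  forall p q : R, 0 <= p -> p <= q -> forest_prob G q P <= forest_prob G p P.
Proof.
move=> anti p q; rewrite le_eqVlt => /predU1P[<-|p0 pq]; last exact: anti.
rewrite le_eqVlt => /predU1P[<-//|q0].
have cvg0 := @forest_prob_cvg0 P; rewrite -(cvg_lim _ cvg0)//.
apply: limr_ge; first exact: cvgP cvg0.
near=> s; apply: anti; first by near: s; exact: nbhs_right_gt.
by apply: ltW; near: s; exact: nbhs_right_lt.
Unshelve. all: by end_near. Qed.

(** The hypothesis on forest sums is the cross-multiplied inequality between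
    probabilities at positive intensities. *)
Lemma forest_prob_antitone P (Q : pred {ffun V -> option V}) :
  (forall phi, P (graph_of phi) = Q phi) ->
  (forall p q : R, 0 < p -> p <= q ->
     forest_sum (edge_weight G) q Q * forest_sum (edge_weight G) p predT <=
     forest_sum (edge_weight G) p Q * forest_sum (edge_weight G) q predT) ->
  forall p q : R, 0 <= p -> p <= q -> forest_prob G q P <= forest_prob G p P.
Proof.
move=> PQ anti; apply: antitone_extends0 => p q p0 pq.
have q0 := lt_le_trans p0 pq; rewrite !forest_probE//.
have Z0 r : 0 < r -> 0 < forest_sum (edge_weight G) r predT.
  by move=> r0; apply: forest_sum_gt0 => //; exact: edge_weight_ge0.
rewrite ler_pdivrMr ?Z0// mulrAC ler_pdivlMr ?Z0//.
have PQE r : forest_sum (edge_weight G) r (P \o @graph_of V) = forest_sum (edge_weight G) r Q.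
  exact: forest_sum_eq.
by rewrite !PQE; exact: anti.
Qed.

Lemma prob_pm_subset_antitone (A : {set V * V}) (p q : R) : symmetric_graph G ->
  0 <= p -> p <= q -> prob_pm_subset G A q <= prob_pm_subset G A p.
Proof.
move=> symG; apply: (@forest_prob_antitone _ (has_edges (enum A))).
  move=> phi; rewrite /has_edges; apply/forall_inP/allP => edgesA e.
    by rewrite mem_enum => /edgesA; case: e => a b; rewrite !in_graph_of.
  move=> eA; have := edgesA e; rewrite mem_enum => /(_ eA).
  by case: e {eA} => a b; rewrite !in_graph_of.
move=> {}p {}q p0 pq; apply: edges_antitone => //; first exact: edge_weight_sym.
exact: edge_weight_ge0.
Qed.

Lemma U_compl x y q : 0 < q ->
  U G x y q = 1 - forest_prob G q (fun F => ~~ different_trees F x y).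
Proof.
move=> q0; rewrite /U !forest_prob_gibbs// -(gibbs_sum1 G q0).
by rewrite [in RHS](bigID (fun F => different_trees F x y)) /= addrK.
Qed.

(** Two vertices are in the same tree with a probability that does not increase,
    by [linked_antitone]; passing to the complement is valid at 0 by continuity. *)
Lemma U_monotone x y p q : symmetric_graph G ->
  0 <= p -> p <= q -> U G x y p <= U G x y q.
Proof.
move=> symG p0 pq.
have U_complE r : 0 <= r -> U G x y r = 1 - forest_prob G r (fun F => ~~ different_trees F x y).
  rewrite le_eqVlt => /predU1P[<-|]; last exact: U_compl.
  apply: (cvg_unique _ (@forest_prob_cvg0 _)) => //.
  apply: cvg_trans (cvgB (cvg_cst (1 : R))
    (@forest_prob_cvg0 (fun F => ~~ different_trees F x y))).
  by apply: near_eq_cvg; near=> s; rewrite -[LHS]U_compl.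
rewrite !U_complE ?(le_trans p0)// lerD2l lerN2.
apply: (@forest_prob_antitone _ (linked x y)) => // [phi|{p0 pq}p {}q p0 pq].
  by rewrite different_trees_graph_of negbK.
apply: linked_antitone => //; [exact: edge_weight_sym|exact: edge_weight_ge0].
Unshelve. all: by end_near. Qed.

(** The ratio of the masses of [F] and [H] is at most a constant times q, since
    [H] has fewer roots. *)
Lemma gibbs_vanishes0 F H : F \in forests G -> H \in forests G ->
  0 < forest_weight G H -> (#|forest_roots H| < #|forest_roots F|)%N ->
  gibbs G q F @[q --> 0^'+] --> (0 : R).
Proof.
move=> FG HG wH lt_roots; set c := forest_weight G F / forest_weight G H.
have c0 : 0 <= c by rewrite divr_ge0 ?forest_weight_ge0.
apply: (@squeeze_cvgr _ _ _ _ (cst 0) (fun q => q * c)).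
- near=> q; have q0 : 0 < q by near: q; exact: nbhs_right_gt.
  have q1 : q <= 1 by apply: ltW; near: q; exact: nbhs_right_lt.
  rewrite /= gibbs_ge0//= /gibbs ler_pdivrMr ?partition_fun_gt0//.
  have ZH : q ^+ #|forest_roots H| * forest_weight G H <= partition_fun G q.
    rewrite /partition_fun (bigD1 H) //= lerDl sumr_ge0// => F' /andP[F'G _].
    by rewrite mulr_ge0 ?exprn_ge0 ?forest_weight_ge0// ltW.
  apply: (le_trans _ (ler_wpM2l (mulr_ge0 (ltW q0) c0) ZH)).
  rewrite [X in _ <= _ * X]mulrC mulrA -[q * c * _]mulrA divfK ?gt_eqF//.
  rewrite mulrAC -exprS ler_wpM2r ?forest_weight_ge0//.
  by rewrite ler_wiXn2l// ltW.
- exact: cvg_cst.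
- rewrite -[X in _ --> X](mul0r c).
  by apply: cvgM; [apply: cvg_at_right_filter; exact: cvg_id | exact: cvg_cst].
Unshelve. all: by end_near. Qed.

(** A separating forest of positive weight is dominated, as q tends to 0, by a
    forest of positive weight with fewer roots. *)
Lemma U_at0 x y : symmetric_graph G -> pos_connected G x y -> U G x y 0 = 0.
Proof.
move=> symG xy; rewrite /U /forest_prob big1// => F /andP[FG diffF].
rewrite /forest_law eqxx; apply: cvg_lim => //.
have [w0|wF] := eqVneq (forest_weight G F) 0.
  rewrite (_ : gibbs G ^~ F = cst 0); first exact: cvg_cst.
  by apply/funext => q; rewrite /gibbs w0 mulr0 mul0r.
pose pw : rel V := [rel u v | ((u, v) \in edges G) && (0 < weight G (u, v))].
have pw_sym : symmetric pw.
  suff pwS u v : pw u v -> pw v u by move=> u v; apply/idP/idP; exact: pwS.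
  by move=> /andP[/symG[vu wE] wuv]; rewrite /pw /= vu -wE.
have FE := forests_graph_of FG; set phi := parent_of F in FE.
move: (FG); rewrite -{1}FE graph_of_forests FE => /andP[/fintype.subsetP subF rphi].
have pw_phi u v : phi u = Some v -> pw u v.
  move=> uv; have uvF : (u, v) \in F by rewrite -FE in_graph_of uv.
  rewrite /pw /= subF//= lt_neqAle weight_ge0 ?subF// andbT eq_sym.
  by apply: contra_neq wF => uv0; rewrite /forest_weight (bigD1 (u, v)) //= uv0 mul0r.
move: diffF; rewrite -FE different_trees_graph_of => Nxy.
have [phi' [rphi' pw_phi' lt_roots]] := fewer_roots pw_sym rphi pw_phi xy Nxy.
have phi'E e : e \in graph_of phi' -> (e \in edges G) && (0 < weight G e).
  by case: e => u v; rewrite in_graph_of => /eqP/pw_phi'.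
rewrite FE; apply: (@gibbs_vanishes0 _ (graph_of phi')) => //.
- rewrite graph_of_forests rphi' andbT.
  by apply/fintype.subsetP => e /phi'E /andP[].
- by apply: prodr_gt0 => e /phi'E /andP[].
- by rewrite -FE !forest_roots_graph_of.
Qed.

Lemma empty_forest_roots : #|forest_roots (finset.set0 : {set V * V})| = #|V|.
Proof.
by rewrite -cardsT; apply: eq_card => x; rewrite !inE; apply/forallP => y; rewrite inE.
Qed.

Lemma nonempty_forest_roots F : F != finset.set0 -> (#|forest_roots F| < #|V|)%N.
Proof.
case/set0Pn => -[x y] xyF; rewrite -cardsT; apply: proper_card.
apply/properP; split; first exact: finset.subsetT.
by exists x; rewrite ?inE//; apply/forallPn; exists y; rewrite negbK.
Qed.

(** Dividing the partition function by its leading power of q leaves a polynomial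
    in 1/q whose constant term comes from the empty forest alone. *)
Lemma gibbs_empty_cvg : gibbs G q finset.set0 @[q --> +oo] --> (1 : R).
Proof.
pose Zinv (t : R) := \sum_(F in forests G) t ^+ (#|V| - #|forest_roots F|) * forest_weight G F.
have Zinv0 : Zinv 0 = 1.
  rewrite /Zinv (bigD1 finset.set0) ?set0_forests//= empty_forest_roots subnn.
  rewrite forest_weight0 mulr1 big1 ?addr0// => F /andP[_ F0].
  by rewrite expr0n subn_eq0 leqNgt nonempty_forest_roots// mul0r.
have cZ : continuous Zinv.
  move=> s; apply: cvg_big => [|F _]; first exact: add_continuous.
  by apply: cvgM; [exact: exprn_continuous | exact: cvg_cst].
have invq : q^-1 @[q --> +oo] --> (0 : R).
  by apply/(@gtr0_cvgV0 _ _ _ _ id); [exact: nbhs_pinfty_gt | exact: cvg_id].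
have lim1 : (Zinv q^-1)^-1 @[q --> +oo] --> (1 : R).
  rewrite -[X in _ --> X]invr1 -Zinv0; apply: cvgV; first by rewrite Zinv0 oner_neq0.
  exact: (cvg_comp _ _ invq (cZ 0)).
apply: cvg_trans lim1; apply: near_eq_cvg; near=> q.
have q0 : 0 < q by near: q; exact: nbhs_pinfty_gt.
rewrite /gibbs empty_forest_roots forest_weight0 mulr1.
have -> : partition_fun G q = q ^+ #|V| * Zinv q^-1.
  rewrite /Zinv mulr_sumr; apply: eq_bigr => F _; rewrite mulrA; congr (_ * _).
  rewrite -{1}(subnKC (max_card (mem (forest_roots F)))) exprD exprVn mulfK//.
  by rewrite expf_neq0// gt_eqF.
by rewrite invfM mulrA divff ?mul1r// expf_neq0// gt_eqF.
Unshelve. all: by end_near. Qed.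

(** The empty forest separates x from y and has probability tending to 1. *)
Lemma U_cvg1 x y : x != y -> U G x y q @[q --> +oo] --> (1 : R).
Proof.
move=> xy; apply: (@squeeze_cvgr _ _ _ _ (gibbs G ^~ finset.set0) (cst 1)).
- near=> q; have q0 : 0 < q by near: q; exact: nbhs_pinfty_gt.
  rewrite [X in _ && X]forest_prob_le1// andbT /U forest_prob_gibbs//.
  rewrite (bigD1 finset.set0) /=; last first.
    rewrite set0_forests /different_trees; apply: contra xy => /connectP[[|a p]].
      by move=> _ /= ->.
    by rewrite /edge_rel /= !inE.
  by rewrite lerDl sumr_ge0// => F /andP[/andP[FG _] _]; exact: gibbs_ge0.
- exact: gibbs_empty_cvg.
- exact: cvg_cst.
Unshelve. all: by end_near. Qed.

End RandomForest.

Local Open Scope classical_set_scope.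
Theorem theorem2 (R : realType) (V : finType) (G : wdigraph R V)
    (hG : symmetric_graph G) :
  (forall A : {set V * V}, A \subset edges G ->
     forall p q : R, 0 <= p -> p <= q ->
       prob_pm_subset G A q <= prob_pm_subset G A p)
  /\
  (forall x y : V, x != y ->
     [/\ {within `[0, +oo[, continuous (U G x y)},
         (forall p q : R, 0 <= p -> p <= q -> U G x y p <= U G x y q),
         (pos_connected G x y -> U G x y 0 = 0)
       & U G x y q @[q --> +oo] --> (1 : R)]).
Proof.
split=> [A _ p q p0 pq|x y xy]; first exact: prob_pm_subset_antitone.
split; [exact: forest_prob_within_continuous | | exact: U_at0 | exact: U_cvg1].
by move=> p q; exact: U_monotone.
Qed.
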